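(* There is a constant $C>0$ depending only on $d$ with the following property. Let $R:\mathbb R^d\to(0,\infty)$ satisfy $|R(x)-R(y)|\le|x-y|$ for all $x,y$, let $\rho$ be the corresponding special metric, and let $U\subset\mathbb R^d$ be a closed set. Then there exists a $C^2$ function $f:\mathbb R^d\to[0,1]$ such that $f(x)=1$ for all $x\in U$, $f(x)=0$ for all $x\in\mathbb R^d\setminus U_{+4}$, and \[ \int_{\mathbb R^d}\big(R|\nabla f|+R^2|\nabla^2 f|\big)\,dm\le C\int_{U_{+4}\setminus U} f\,dm. \]
   Context: The special metric corresponding to $R$ is $\rho(x,y)=\inf_\gamma\int_\gamma \frac{|dz|}{R(z)}$, the infimum over piecewise $C^1$ curves joining $x$ and $y$. For $r>0$, $U_{+r}=\{y:\exists x\in U,\ \rho(x,y)\le r\}$. $m$ is Lebesgue measure on $\mathbb R^d$; $|\nabla f(x)|=\sum_k|\partial f/\partial x_k|$ and $|\nabla^2f(x)|=\sum_{k,l}|\partial^2 f/\partial x_k\partial x_l|$. *)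

(* Defs.v *)
From HB Require Import structures.
From mathcomp Require Import all_boot all_order all_algebra.
From mathcomp Require Import all_classical all_reals all_analysis.
Set Implicit Arguments. Unset Strict Implicit. Unset Printing Implicit Defensive.
Import Order.TTheory GRing.Theory Num.Theory.
Import numFieldNormedType.Exports.
Local Open Scope classical_set_scope.
Local Open Scope ring_scope.

Section Defs.
Variables (K : realType) (d : nat).

Definition enorm (x : 'rV[K]_d) : K := Num.sqrt (\sum_(k < d) x 0 k ^+ 2).

Definition evec (k : 'I_d) : 'rV[K]_d := delta_mx 0 k.

Definition partial (k : 'I_d) (f : 'rV[K]_d -> K) : 'rV[K]_d -> K :=
  fun x => 'D_(evec k) f x.

Definition C2 (f : 'rV[K]_d -> K) : Prop :=
  continuous f /\
  (forall k x, derivable f x (evec k)) /\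
  (forall k, continuous (partial k f)) /\
  (forall k l x, derivable (partial k f) x (evec l)) /\
  (forall k l, continuous (partial l (partial k f))).

Definition grad_norm (f : 'rV[K]_d -> K) (x : 'rV[K]_d) : K :=
  \sum_(k < d) `| partial k f x |.
Definition hess_norm (f : 'rV[K]_d -> K) (x : 'rV[K]_d) : K :=
  \sum_(k < d) \sum_(l < d) `| partial l (partial k f) x |.

Definition C1_on (a b : K) (g : K -> 'rV[K]_d) : Prop :=
  {within [set t | a <= t <= b], continuous g} /\
  (forall t, a < t < b -> derivable g t 1) /\
  exists g' : K -> 'rV[K]_d,
    {within [set t | a <= t <= b], continuous g'} /\
    (forall t, a < t < b -> derive1 g t = g' t).

Definition piecewise_C1 (g : K -> 'rV[K]_d) : Prop :=
  exists s : seq K,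
    let p := 0 :: rcons s 1 in
    sorted <%R p /\
    forall i, (i < size s + 1)%N -> C1_on (nth 0 p i) (nth 0 p i.+1) g.

Definition curve_integral (Rf : 'rV[K]_d -> K) (g : K -> 'rV[K]_d) : \bar K :=
  (\int[@lebesgue_measure K]_(t in [set t : K | (0 <= t <= 1)%R])
      ((enorm (derive1 g t) / Rf (g t))%:E))%E.

Definition special_metric (Rf : 'rV[K]_d -> K) (x y : 'rV[K]_d) : \bar K :=
  ereal_inf [set l | exists g : K -> 'rV[K]_d,
     [/\ piecewise_C1 g, g 0 = x, g 1 = y & l = curve_integral Rf g]].

Definition neigh (Rf : 'rV[K]_d -> K) (U : set 'rV[K]_d) (r : K) : set 'rV[K]_d :=
  [set y | exists2 x, U x & (special_metric Rf x y <= r%:E)%E].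

Definition setcoord (x : 'rV[K]_d) (k : 'I_d) (t : K) : 'rV[K]_d :=
  \row_j (if j == k then t else x 0 j).

(* Iterated Lebesgue integral over the coordinates in s (Tonelli) *)
Fixpoint iter_int (s : seq 'I_d) (g : 'rV[K]_d -> \bar K) (x : 'rV[K]_d) : \bar K :=
  match s with
  | [::] => g x
  | k :: s' => (\int[@lebesgue_measure K]_(t in setT) iter_int s' g (setcoord x k t))%E
  end.

(* Lebesgue integral over R^d of a nonnegative function *)
Definition int_Rd (g : 'rV[K]_d -> \bar K) : \bar K := iter_int (enum 'I_d) g 0.

End Defs.

(* Main.v *)
Require Import Defs.
From HB Require Import structures.
From mathcomp Require Import all_boot all_order all_algebra.
From mathcomp Require Import all_classical all_reals all_analysis.
From mathcomp Require Import measurable_realfun zify ring lra.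
Set Implicit Arguments. Unset Strict Implicit. Unset Printing Implicit Defensive.
Import Order.TTheory GRing.Theory Num.Theory.
Import numFieldNormedType.Exports.
Local Open Scope classical_set_scope.
Local Open Scope ring_scope.

(** Only short segments are needed to control the special metric: if some u in
    U satisfies |x - u| <= R(x) / (4 (d + 1)) in the sup norm, then
    rho(u, x) <= 1.  Cover the space by grid cubes of side about R / (100 (d + 1)^2),
    put a C^2 bump on each cube whose center is close to U, and let f be a
    smooth step of the sum of these bumps.  The overlap is bounded by a constant
    N depending only on d, so R |grad f| + R^2 |hess f| is bounded by a constant
    and vanishes outside the enlarged cubes meeting the layer where f is not
    locally constant.  Each such cube has a translate, centered midway
    between a point of the layer and a nearby point of U, that avoids U and on
    which f = 1; the translates again have overlap at most N.  Since translation
    preserves volume, summing over the cubes gives the inequality. *)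

(** * Twice continuously differentiable functions *)

(** The truncated power, of class C^(n-1) for positive [n]. The cube is the lowest power that gives
    C^2 bumps. *)
Definition ppow {K : realType} (n : nat) (t : K) : K := Num.max 0 t ^+ n.

Lemma ppow_continuous {K : realType} (n : nat) : continuous (@ppow K n).
Proof.
move=> t; apply: (@continuous_comp _ _ _ (fun t : K => Num.max 0 t) (fun t => t ^+ n)).
  by apply: (@continuous_max K K (cst 0) id); [exact: cst_continuous|exact: cvg_id].
exact: exprn_continuous.
Qed.

Lemma ppow_ge0 {K : realType} (n : nat) (t : K) : 0 <= ppow n t.
Proof. by rewrite exprn_ge0// le_max lexx. Qed.

Lemma ppow0 {K : realType} (n : nat) (t : K) : t <= 0 -> ppow n.+1 t = 0.
Proof. by move=> t0; rewrite /ppow max_l// expr0n. Qed.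

Lemma ppow_gt0 {K : realType} (n : nat) (t : K) : 0 <= t -> ppow n t = t ^+ n.
Proof. by move=> t0; rewrite /ppow max_r. Qed.

Lemma is_derive_ppow {K : realType} (n : nat) (t : K) :
  is_derive t 1 (ppow n.+2) (n.+2%:R * ppow n.+1 t).
Proof.
have [t0|t0|->] := ltgtP t 0.
- rewrite ppow0 ?ltW// mulr0.
  apply: near_eq_is_derive (is_derive_cst (0 : K^o) t 1).
  by near=> x; rewrite ppow0//; near: x; exact: lt_le_nbhsl.
- have dX : is_derive t 1 (fun x : K => x ^+ n.+2) (n.+2%:R * ppow n.+1 t).
    rewrite (_ : (fun x : K => x ^+ n.+2) = id ^+ n.+2); last first.
      by apply/funext => x; rewrite exprfctE.
    apply: (is_derive_eq (is_deriveX n.+2 (is_derive_id (t : K) 1))).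
    by rewrite ppow_gt0 ?ltW// [LHS]mulr1.
  apply: near_eq_is_derive dX.
  by near=> x; rewrite ppow_gt0//; near: x; exact: lt_le_nbhsr.
- rewrite ppow0// mulr0.
  (* At the corner the difference quotient equals [ppow n.+1 h] for every nonzero [h], and this
     tends to [ppow n.+1 0 = 0]. *)
  have g0 : (fun h : K => h^-1 *: (ppow n.+2 (h *: 1 + 0) - ppow n.+2 0)) @ 0^' --> (0 : K).
    have := @ppow_continuous K n.+1 0; rewrite /continuous_at ppow0//.
    move=> /cvg_within_filter => /(_ (fun x => x != 0)) p0.
    apply: cvg_trans p0; apply: near_eq_cvg.
    near=> h; rewrite /= addr0 [_%:A]mulr1 (@ppow0 _ n.+1 0)// subr0.
    have h0 : h != 0 by near: h; exact: nbhs_dnbhs_neq.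
    have [hl|hl] := leP h 0; first by rewrite !ppow0// scaler0.
    by rewrite !ppow_gt0 ?ltW// [in RHS]exprS /GRing.scale/= mulKf.
  by apply: DeriveDef; [apply/cvg_ex; exists 0|exact: cvg_lim g0].
Unshelve. all: by end_near. Qed.

(** A derivative along [v] is the derivative at 0 of the restriction to a line. This reduces
    [is_derive_comp] to the chain rule in one real variable. *)
Lemma is_derive_line {K : realType} {V W : normedModType K} (f : V -> W) (x v : V) (df : W) :
  is_derive (0 : K) 1 (fun h : K => f (h *: v + x)) df -> is_derive x v f df.
Proof.
move=> [dv <-]; apply: DeriveDef; first by exact: (proj2 (derivable1P f x v) dv).
rewrite /derive; set g1 := fun h => h^-1 *: _; set g2 := fun h => h^-1 *: _.
suff -> : g1 = g2 by [].
apply/funext => h; rewrite /g1 /g2 /=.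
by rewrite addr0 scale0r add0r [_%:A]mulr1.
Qed.

Lemma is_derive_toline {K : realType} {V W : normedModType K} (f : V -> W) (x v : V) (df : W) :
  is_derive x v f df -> is_derive (0 : K) 1 (fun h : K => f (h *: v + x)) df.
Proof.
move=> [dv <-]; apply: DeriveDef; first by exact: (proj1 (derivable1P f x v) dv).
rewrite /derive; set g1 := fun h => h^-1 *: _; set g2 := fun h => h^-1 *: _.
suff -> : g1 = g2 by [].
apply/funext => h; rewrite /g1 /g2 /=.
by rewrite addr0 scale0r add0r [_%:A]mulr1.
Qed.

Lemma is_derive_comp {K : realType} {V : normedModType K} (phi : K -> K) (f : V -> K)
    (x v : V) (dphi df : K) :
  is_derive (f x) 1 phi dphi -> is_derive x v f df ->
  is_derive x v (phi \o f) (dphi * df).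
Proof.
move=> dp /is_derive_toline dF; apply: is_derive_line.
apply: (is_derive1_comp (f := phi) (g := fun h : K => f (h *: v + x))).
by rewrite scale0r add0r.
Qed.

(** Carries explicit first and second derivatives along with [f], so that the closure properties
    below also compute the formulas that are estimated later. *)
Definition jet2 {K : realType} {d : nat} (f : 'rV[K]_d -> K)
    (g : 'I_d -> 'rV[K]_d -> K) (h : 'I_d -> 'I_d -> 'rV[K]_d -> K) : Prop :=
  [/\ continuous f, forall k x, is_derive x (evec K k) f (g k x),
      forall k, continuous (g k),
      forall k l x, is_derive x (evec K l) (g k) (h k l x) &
      forall k l, continuous (h k l)].

Lemma jet2_partial {K : realType} {d : nat} (f : 'rV[K]_d -> K) g h k :
  jet2 f g h -> partial k f = g k.
Proof. by move=> [_ df _ _ _]; apply/funext => x; have [_ <-] := df k x. Qed.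

Lemma jet2_partial2 {K : realType} {d : nat} (f : 'rV[K]_d -> K) g h k l :
  jet2 f g h -> partial l (partial k f) = h k l.
Proof.
move=> J; rewrite (jet2_partial _ J); case: J => [_ _ _ dg _].
by apply/funext => x; have [_ <-] := dg k l x.
Qed.

Lemma jet2_cst {K : realType} {d : nat} (c : K) :
  jet2 (fun _ : 'rV[K]_d => c) (fun _ _ => 0) (fun _ _ _ => 0).
Proof.
by split=> *; try exact: is_derive_cst; exact: cst_continuous.
Qed.

Lemma jet2D {K : realType} {d : nat} (f1 f2 : 'rV[K]_d -> K) g1 g2 h1 h2 :
  jet2 f1 g1 h1 -> jet2 f2 g2 h2 ->
  jet2 (fun x => f1 x + f2 x) (fun k x => g1 k x + g2 k x)
       (fun k l x => h1 k l x + h2 k l x).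
Proof.
move=> [cf1 df1 cg1 dg1 ch1] [cf2 df2 cg2 dg2 ch2]; split.
- by move=> x; exact: (continuousD (cf1 x) (cf2 x)).
- by move=> k x; exact: (is_deriveD (df1 k x) (df2 k x)).
- by move=> k x; exact: (continuousD (cg1 k x) (cg2 k x)).
- by move=> k l x; exact: (is_deriveD (dg1 k l x) (dg2 k l x)).
- by move=> k l x; exact: (continuousD (ch1 k l x) (ch2 k l x)).
Qed.

Lemma jet2_sum {K : realType} {d : nat} (I : Type) (r : seq I)
    (f : I -> 'rV[K]_d -> K) g h :
  (forall i, jet2 (f i) (g i) (h i)) ->
  jet2 (fun x => \sum_(i <- r) f i x) (fun k x => \sum_(i <- r) g i k x)
       (fun k l x => \sum_(i <- r) h i k l x).
Proof.
move=> J; elim: r => [|i r IH].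
  have -> : (fun x : 'rV[K]_d => \sum_(i <- [::]) f i x) = fun=> 0.
    by apply/funext => x; rewrite big_nil.
  have -> : (fun k x => \sum_(i <- [::]) g i k x) = fun=> fun=> 0.
    by apply/funext => k; apply/funext => x; rewrite big_nil.
  have -> : (fun k l x => \sum_(i <- [::]) h i k l x) = fun=> fun=> fun=> 0.
    by apply/funext => k; apply/funext => l; apply/funext => x; rewrite big_nil.
  exact: jet2_cst.
have -> : (fun x : 'rV[K]_d => \sum_(i <- i :: r) f i x) =
          fun x => f i x + \sum_(i <- r) f i x.
  by apply/funext => x; rewrite big_cons.
have -> : (fun k x => \sum_(i <- i :: r) g i k x) =
          fun k x => g i k x + \sum_(i <- r) g i k x.
  by apply/funext => k; apply/funext => x; rewrite big_cons.
have -> : (fun k l x => \sum_(i <- i :: r) h i k l x) =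
          fun k l x => h i k l x + \sum_(i <- r) h i k l x.
  by apply/funext => k; apply/funext => l; apply/funext => x; rewrite big_cons.
exact: jet2D.
Qed.

Lemma jet2_comp {K : realType} {d : nat} (phi phi1 phi2 : K -> K)
    (f : 'rV[K]_d -> K) g h :
  (forall t : K, is_derive t 1 phi (phi1 t)) ->
  (forall t : K, is_derive t 1 phi1 (phi2 t)) -> continuous phi2 ->
  jet2 f g h ->
  jet2 (fun x => phi (f x)) (fun k x => phi1 (f x) * g k x)
    (fun k l x => phi2 (f x) * g l x * g k x + phi1 (f x) * h k l x).
Proof.
move=> d1 d2 c2 [cf df cg dg ch].
have ctn (u v : K -> K) : (forall t : K, is_derive t 1 u (v t)) -> continuous u.
  by move=> du t; apply/differentiable_continuous/derivable1_diffP; have [] := du t.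
have cphi (u : K -> K) : continuous u -> continuous (fun x => u (f x)).
  by move=> cu x; exact: (@continuous_comp _ _ _ f u x (cf x) (cu _)).
split.
- exact/cphi/(ctn _ _ d1).
- by move=> k x; exact: (is_derive_comp (d1 _) (df k x)).
- by move=> k x; exact: (continuousM (cphi _ (ctn _ _ d2) x) (cg k x)).
- move=> k l x.
  have := is_deriveM (is_derive_comp (d2 (f x)) (df l x)) (dg k l x).
  move/is_derive_eq; apply.
  rewrite /GRing.scale/= addrC; congr (_ + _).
  by rewrite mulrC.
- move=> k l x.
  exact: (continuousD
    (continuousM (continuousM (cphi _ c2 x) (cg l x)) (cg k x))
    (continuousM (cphi _ (ctn _ _ d2) x) (ch k l x))).
Qed.

Lemma jet2_coord {K : realType} {d : nat} (j : 'I_d) :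
  jet2 (fun x : 'rV[K]_d => x 0 j) (fun k _ => (j == k)%:R) (fun _ _ _ => 0).
Proof.
split=> [|k x|k|k l x|k l]; first exact: coord_continuous.
- apply: is_derive_line.
rewrite (_ : (fun _ => _) = (fun t => (j == k)%:R *: t + x 0 j)); last first.
  by apply/funext => t; rewrite /evec !mxE/= /GRing.scale/= mulrC.
have := is_deriveD (is_deriveZ (j == k)%:R (is_derive_id (0 : K^o) 1))
  (is_derive_cst (x 0 j : K^o) (0 : K^o) 1).
move=> dd; apply: (is_derive_eq dd).
by rewrite addr0 /GRing.scale/= mulr1.
- exact: cst_continuous.
- exact: is_derive_cst.
- exact: cst_continuous.
Qed.

(** An equality that holds near [x] also holds near every point close to [x]. The conclusion is
    again a local equality, so the lemma can be iterated for second derivatives. *)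
Lemma near_partial {K : realType} {d : nat} (f F : 'rV[K]_d -> K) (k : 'I_d) (x : 'rV[K]_d) :
  (\near x, f x = F x) -> \near x, partial k f x = partial k F x.
Proof.
move=> /near_join fF; near=> y; apply: near_eq_derive.
by near: y.
Unshelve. all: by end_near. Qed.

Lemma near_eq_continuous {K : realType} {V : topologicalType} (f F : V -> K) (x : V) :
  (\near x, f x = F x) -> {for x, continuous F} -> {for x, continuous f}.
Proof.
move=> fF cF; rewrite /continuous_at /prop_for (nbhs_singleton fF).
apply: cvg_trans cF; apply: near_eq_cvg.
by near=> y; apply/esym; near: y.
Unshelve. all: by end_near. Qed.

(** Being C^2 is a local property. The jet may vary with the point, as it must for the cutoff, which
    is only locally a function of a fixed finite sum of bumps. *)
Lemma jet2_near {K : realType} {d : nat} (f : 'rV[K]_d -> K) :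
  (forall x : 'rV[K]_d, exists F g h, jet2 F g h /\ \near x, f x = F x) -> C2 f.
Proof.
move=> J; split.
  by move=> x; have [F [g [h [[cF _ _ _ _] fF]]]] := J x; exact: near_eq_continuous fF (cF x).
split.
  move=> k x; have [F [g [h [[_ dF _ _ _] fF]]]] := J x.
  apply: near_eq_derivable (ex_derive (is_derive := dF k x)).
  by near=> y; apply/esym; near: y.
split.
  move=> k x; have [F [g [h [jF fF]]]] := J x.
  have [_ _ cg _ _] := jF.
  apply: near_eq_continuous (near_partial k fF) _.
  by rewrite (jet2_partial _ jF); exact: cg.
split=> [k l x|k l x]; have [F [g [h [jF fF]]]] := J x; have [_ _ _ dg ch] := jF.
  apply: near_eq_derivable (ex_derive (is_derive := dg k l x)).
  have := near_partial k fF; rewrite (jet2_partial _ jF) => fg.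
  by near=> y; apply/esym; near: y.
apply: near_eq_continuous (near_partial l (near_partial k fF)) _.
by rewrite (jet2_partial2 _ _ jF); exact: ch.
Unshelve. all: by end_near. Qed.

(** * Bump functions and the smooth step *)

Definition qform {K : realType} {d : nat} (q : 'rV[K]_d) (s : K) (x : 'rV[K]_d) : K :=
  \sum_(j < d) ((x 0 j - q 0 j) / s) ^+ 2.

Lemma jet2_qform {K : realType} {d : nat} (q : 'rV[K]_d) (s : K) :
  jet2 (qform q s) (fun k x => 2 * ((x 0 k - q 0 k) / s) / s)
    (fun k l _ => (k == l)%:R * 2 / s ^+ 2).
Proof.
have daff (j : 'I_d) (t : K) : is_derive t 1 (fun t : K => (t - q 0 j) / s) s^-1.
  rewrite (_ : (fun _ => _) = s^-1 *: (id - cst (q 0 j) : K -> K)); last first.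
    by apply/funext => u; rewrite mulrC.
  apply: (is_derive_eq (is_deriveZ s^-1 (is_deriveB (is_derive_id (t : K^o) 1)
    (is_derive_cst (q 0 j : K^o) (t : K^o) 1)))).
  by rewrite subr0 /GRing.scale/= mulr1.
have dphi (j : 'I_d) (t : K) :
    is_derive t 1 (fun t : K => ((t - q 0 j) / s) ^+ 2) (2 * ((t - q 0 j) / s) / s).
  rewrite (_ : (fun _ => _) = (fun t : K => (t - q 0 j) / s) ^+ 2); last first.
    by apply/funext => u; rewrite exprfctE.
  by apply: (is_derive_eq (is_deriveX 2 (daff j t))).
have dphi1 (j : 'I_d) (t : K) :
    is_derive t 1 (fun t : K => 2 * ((t - q 0 j) / s) / s) (2 / s ^+ 2).
  rewrite (_ : (fun _ => _) = (2 / s) *: (fun t : K => (t - q 0 j) / s)); last first.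
    by apply/funext => u; rewrite /= mulrAC.
  apply: (is_derive_eq (is_deriveZ (2 / s) (daff j t))).
  by rewrite /GRing.scale/= -mulrA -invfM -expr2.
have J := jet2_sum (index_enum 'I_d) (fun j =>
  jet2_comp (dphi j) (dphi1 j) (@cst_continuous _ _ _) (@jet2_coord K d j)).
have E1 : (fun k (x : 'rV[K]_d) => 2 * ((x 0 k - q 0 k) / s) / s) =
  (fun k x => \sum_(j < d) 2 * ((x 0 j - q 0 j) / s) / s * (j == k)%:R).
  apply/funext => k; apply/funext => x.
  rewrite (bigD1 k)//= eqxx mulr1 big1 ?addr0// => j /negPf->.
  by rewrite mulr0.
have E2 : (fun k l (_ : 'rV[K]_d) => (k == l)%:R * 2 / s ^+ 2) =
  (fun k l x => \sum_(j < d) (2 / s ^+ 2 * (j == l)%:R * (j == k)%:R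
    + 2 * ((x 0 j - q 0 j) / s) / s * 0)).
  apply/funext => k; apply/funext => l; apply/funext => x.
  rewrite (bigD1 k)//= eqxx !mulr1 mulr0 addr0 big1 ?addr0; last first.
    by move=> j /negPf->; rewrite !mulr0 addr0.
  by rewrite -mulrA mulrC.
by rewrite E1 E2.
Qed.

(** The threshold [d.+1] separates two cubes: on the sup-norm cube of radius [s] the form is at most
    [d], so the bump is at least 1, and a positive bump forces the point into the cube of radius
    [d.+1 * s]. *)
Definition bumpf {K : realType} {d : nat} (q : 'rV[K]_d) (s : K) (x : 'rV[K]_d) : K :=
  ppow 3 (d.+1%:R - qform q s x).

Definition bumpf1 {K : realType} {d : nat} (q : 'rV[K]_d) (s : K) (k : 'I_d) (x : 'rV[K]_d) : K :=
  - (3 * ppow 2 (d.+1%:R - qform q s x)) * (2 * ((x 0 k - q 0 k) / s) / s).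

Definition bumpf2 {K : realType} {d : nat} (q : 'rV[K]_d) (s : K) (k l : 'I_d) (x : 'rV[K]_d) : K :=
  6 * ppow 1 (d.+1%:R - qform q s x) * (2 * ((x 0 l - q 0 l) / s) / s)
    * (2 * ((x 0 k - q 0 k) / s) / s)
  + - (3 * ppow 2 (d.+1%:R - qform q s x)) * ((k == l)%:R * 2 / s ^+ 2).

Lemma is_derive_ppowB {K : realType} (n : nat) (a t : K) :
  is_derive t 1 (fun t => ppow n.+2 (a - t)) (- (n.+2%:R * ppow n.+1 (a - t))).
Proof.
have dB : is_derive t 1 (fun t : K => a - t) (- 1).
  apply: (is_derive_eq (is_deriveB (is_derive_cst (a : K^o) (t : K^o) 1)
    (is_derive_id (t : K^o) 1))).
  by rewrite sub0r.
have dd := is_derive_comp (f := fun t => a - t) (is_derive_ppow n (a - t)) dB.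
by rewrite -mulrN1; exact: dd.
Qed.

Lemma jet2_bumpf {K : realType} {d : nat} (q : 'rV[K]_d) (s : K) :
  jet2 (bumpf q s) (bumpf1 q s) (bumpf2 q s).
Proof.
have d1 := fun t : K => is_derive_ppowB 1 d.+1%:R t.
apply: (jet2_comp (phi2 := fun t => 6 * ppow 1 (d.+1%:R - t)) d1 _ _ (jet2_qform q s)).
- move=> t.
  have := is_deriveZ (- 3 : K) (is_derive_ppowB 0 d.+1%:R t).
  rewrite (_ : _ \*: _ = (fun t => - (3 * ppow 2 (d.+1%:R - t)))); last first.
    by apply/funext => u; rewrite -mulNr.
  by move=> dd; apply: (is_derive_eq dd); rewrite /GRing.scale/=; ring.
- move=> t; apply: (@continuousM K K (cst 6) (fun t => ppow 1 (d.+1%:R - t))).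
    exact: cst_continuous.
  apply: (@continuous_comp _ _ _ (fun t : K => d.+1%:R - t) (ppow 1)); last exact: ppow_continuous.
  by apply: (@continuousB _ K^o K^o (cst _) id); [exact: cst_continuous|exact: cvg_id].
Qed.

(* Only used on [t >= 0], where it takes values in [0, 1]; it is negative for [t < 0]. *)
Definition step {K : realType} (t : K) : K := 1 - ppow 3 (1 - t).

Lemma jet2_step {K : realType} {d : nat} (f : 'rV[K]_d -> K) g h : jet2 f g h ->
  jet2 (fun x => step (f x)) (fun k x => 3 * ppow 2 (1 - f x) * g k x)
    (fun k l x => - (6 * ppow 1 (1 - f x)) * g l x * g k x
                  + 3 * ppow 2 (1 - f x) * h k l x).
Proof.
move=> J.
apply: (jet2_comp (phi1 := fun t => 3 * ppow 2 (1 - t))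
  (phi2 := fun t => - (6 * ppow 1 (1 - t))) _ _ _ J).
- move=> t; have := is_deriveB (is_derive_cst (1 : K^o) (t : K^o) 1) (is_derive_ppowB 1 1 t).
  by move=> dd; apply: (is_derive_eq dd); rewrite sub0r opprK.
- move=> t.
  have dd := is_deriveZ (3 : K) (is_derive_ppowB 0 1 t).
  by apply: (is_derive_eq dd); rewrite /GRing.scale/=; ring.
- rewrite (_ : (fun t => - (6 * _)) = (fun t => -6 * ppow 1 (1 - t))); last first.
    by apply/funext => t; rewrite mulNr.
  move=> t; apply: (@continuousM K K (cst (-6)) (fun t => ppow 1 (1 - t))).
    exact: cst_continuous.
  apply: (@continuous_comp _ _ _ (fun t : K => 1 - t) (ppow 1)); last exact: ppow_continuous.
  by apply: (@continuousB _ K^o K^o (cst _) id); [exact: cst_continuous|exact: cvg_id].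
Qed.

(** * Iterated integrals of cubes *)

(* Unlike the library lemma [ge0_le_integral], no measurability is required:
   the integral of a nonnegative function is a supremum over the simple
   functions below it. *)
Lemma ge0_le_integral_any {d : measure_display} {T : measurableType d} {R : realType}
    (mu : {measure set T -> \bar R}) (D : set T) (f g : T -> \bar R) :
  (forall x, D x -> 0 <= f x)%E -> (forall x, D x -> f x <= g x)%E ->
  (\int[mu]_(x in D) f x <= \int[mu]_(x in D) g x)%E.
Proof.
move=> f0 fg; rewrite !ge0_integralE//; last first.
  by move=> x Dx; exact: le_trans (f0 x Dx) (fg x Dx).
apply: ereal_sup_le => _ [h hf <-]; exists h => // x.
apply: le_trans (hf x) _; rewrite /patch; case: ifPn => // /set_mem.
exact: fg.
Qed.

Lemma iter_int_ge0 {K : realType} {d : nat} (s : seq 'I_d) (f : 'rV[K]_d -> \bar K) x :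
  (forall x, 0 <= f x)%E -> (0 <= iter_int s f x)%E.
Proof.
by move=> f0; elim: s x => //= k s IH x; apply: integral_ge0 => t _; exact: IH.
Qed.

(** The energy and the cutoff enter the integral estimate only through this monotonicity; exact
    evaluation is reserved for series of cubes. *)
Lemma le_iter_int {K : realType} {d : nat} (s : seq 'I_d) (f g : 'rV[K]_d -> \bar K) x :
  (forall x, 0 <= f x)%E -> (forall x, f x <= g x)%E ->
  (iter_int s f x <= iter_int s g x)%E.
Proof.
move=> f0 fg; elim: s x => //= k s IH x.
by apply: ge0_le_integral_any => t _; [exact: iter_int_ge0|exact: IH].
Qed.

(** With the full list of coordinates and a nonnegative radius this is the indicator of a closed
    sup-norm ball ([cubeE]). Sublists occur because the iterated integral removes one coordinate at
    a time. *)
Definition cube {K : realType} {d : nat} (r : seq 'I_d) (q : 'rV[K]_d) (a : K)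
    (x : 'rV[K]_d) : K :=
  \prod_(j <- r) \1_`[q 0 j - a, q 0 j + a] (x 0 j).

Lemma cube_ge0 {K : realType} {d : nat} (r : seq 'I_d) (q : 'rV[K]_d) a x : 0 <= cube r q a x.
Proof. by apply: prodr_ge0 => j _; rewrite indicE. Qed.

Lemma cube_setcoord {K : realType} {d : nat} (r : seq 'I_d) k (q : 'rV[K]_d) a x t :
  k \notin r ->
  cube (rcons r k) q a (setcoord x k t) = cube r q a x * \1_`[q 0 k - a, q 0 k + a] t.
Proof.
move=> kr; rewrite /cube big_rcons/= /setcoord mxE eqxx; congr (_ * _).
apply: eq_big_seq => j jr; rewrite mxE.
by case: eqP => // jk; rewrite -jk jr in kr.
Qed.

(** Induction on [s], with [r] holding the coordinates not integrated by the inner integrals. Each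
    further integral commutes with the nonnegative series and replaces one indicator by the length
    [2 * a m]. *)
Lemma iter_int_cubes {K : realType} {d : nat} (w a : nat -> K) (q : nat -> 'rV[K]_d)
    (r s : seq 'I_d) x :
  (forall m, 0 <= w m) -> (forall m, 0 <= a m) -> uniq (r ++ s) ->
  iter_int s (fun x => \sum_(m <oo) (w m * cube (r ++ s) (q m) (a m) x)%:E)%E x =
  (\sum_(m <oo) (w m * (2 * a m) ^+ size s * cube r (q m) (a m) x)%:E)%E.
Proof.
move=> w0 a0; elim: s r x => [r x _|k s IH r x].
  by rewrite /= cats0; apply: eq_eseriesr => m _; rewrite expr0 mulr1.
rewrite -cat_rcons => u /=.
have kr : k \notin r.
  by move: u; rewrite cat_uniq rcons_uniq => /andP[/andP[]].
under eq_integral do rewrite IH//.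
rewrite integral_nneseries//; last 2 first.
- move=> m; under eq_fun do rewrite cube_setcoord//.
  apply/measurable_EFinP; apply: measurable_funM => //.
  by apply: measurable_funM => //; exact: measurable_indic.
- by move=> m t _; rewrite lee_fin !mulr_ge0 ?exprn_ge0 ?cube_ge0// mulr_ge0.
apply: eq_eseriesr => m _.
under eq_integral do rewrite cube_setcoord// mulrA EFinM.
rewrite ge0_integralZl_EFin//; last 2 first.
- by apply/measurable_EFinP; exact: measurable_indic.
- by rewrite !mulr_ge0 ?exprn_ge0 ?cube_ge0// mulr_ge0.
rewrite integral_indic//= setIT.

have -> : (lebesgue_measure `[(q m 0 k - a m)%R, (q m 0 k + a m)%R] = (2 * a m)%:E)%E.
  rewrite lebesgue_measure_itv/= lte_fin.
  (* The remaining case is the degenerate interval, where the radius is 0. *)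
  case: ltP => [_|]; first by rewrite -EFinB; congr EFin; ring.
  move=> h; have -> : a m = 0 by have := a0 m; lra.
  by rewrite mulr0.
by rewrite -EFinM exprS; congr EFin; ring.
Qed.

Lemma int_Rd_cubes {K : realType} {d : nat} (w a : nat -> K) (q : nat -> 'rV[K]_d) :
  (forall m, 0 <= w m) -> (forall m, 0 <= a m) ->
  int_Rd (fun x => \sum_(m <oo) (w m * cube (enum 'I_d) (q m) (a m) x)%:E)%E =
  (\sum_(m <oo) (w m * (2 * a m) ^+ d)%:E)%E.
Proof.
move=> w0 a0; rewrite /int_Rd (iter_int_cubes (r := [::]) q)//= ?enum_uniq//.
by apply: eq_eseriesr => m _; rewrite /cube big_nil mulr1 size_enum_ord.
Qed.

(** The norm on row vectors is the sup norm. The sign of [a] matters when [d = 0], where the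
    right-hand side is vacuously true. *)
Lemma normrV_le {K : realType} {d : nat} (v : 'rV[K]_d) (a : K) : 0 <= a ->
  (`|v| <= a) = [forall j, `|v 0 j| <= a].
Proof.
move=> a0; rewrite /Num.Def.normr/= mx_normrE; apply/idP/forallP => [h j|h].
  exact: le_trans (le_bigmax _ (fun ij => `|v ij.1 ij.2|) (ord0, j)) h.
by apply: bigmax_le => // -[i j] _ /=; rewrite ord1; exact: h.
Qed.

Lemma cubeE {K : realType} {d : nat} (q : 'rV[K]_d) (a : K) x : 0 <= a ->
  cube (enum 'I_d) q a x = (`|x - q| <= a)%R%:R.
Proof.
move=> a0; rewrite normrV_le//; case: forallP => h.
  rewrite /cube big1// => j _; rewrite indicE mem_set//= in_itv/=.
  by have := h j; rewrite !mxE ler_distl.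
have [j hj] : exists j, ~~ (`|(x - q) 0 j| <= a).
  by apply/existsP; rewrite -negb_forall; apply/forallP.
rewrite /cube (bigD1_seq j) ?mem_enum ?enum_uniq//= indicE memNset ?mul0r//=.
by rewrite in_itv/= -ler_distl; move: hj; rewrite !mxE => /negP.
Qed.

(** * Grid points at all dyadic scales *)

Lemma exists_expz2 {K : realType} (t : K) : 0 < t ->
  exists n : int, (2 : K) ^ n <= t < 2 * 2 ^ n.
Proof.
move=> t0; have l2 : 0 < ln (2 : K) by rewrite ln_gt0// ltr1n.
have tE : t = 2 `^ (ln t / ln 2).
  by rewrite /powR pnatr_eq0/= divfK ?gt_eqF// lnK.
set u := ln t / ln 2 in tE; exists (Num.floor u).
have /andP[f1 f2] := floor_itv u.
have -> : 2 * 2 ^ Num.floor u = 2 ^ (Num.floor u + 1) :> K.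
  by rewrite expfzDr// expr1z mulrC.
rewrite -!powR_intmul// tE; apply/andP; split.
  by apply: ler_powR => //; rewrite ler1n.
by rewrite /powR pnatr_eq0/= ltr_expR ltr_pM2r.
Qed.

(** Codes an integer close to [p] by a natural number below [2m + 3], which makes the candidates in
    [grid_count] a finite type. *)
Lemma absz_offset (k p : int) (m : nat) : k < p + 1 + m%:Z -> p - m%:Z < k ->
  (absz (k - p + m.+1%:Z)%R < m.*2.+3)%N /\
  k = p - m.+1%:Z + (absz (k - p + m.+1%:Z)%R)%:Z.
Proof. by lia. Qed.

Section Grid.
Variables (K : realType) (d : nat).

(** The exponent of a dyadic scale and the integer coordinates of a grid point. Being countable,
    this type can be enumerated by [pickle] when the cubes are summed. *)
Definition gidx := (int * {ffun 'I_d -> int})%type.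

Definition gscale (i : gidx) : K := 2 ^ i.1.

Definition gcenter (i : gidx) : 'rV[K]_d := \row_j (gscale i * (i.2 j)%:~R).

Lemma gscale_gt0 i : 0 < gscale i.
Proof. exact: exprz_gt0. Qed.

Lemma exists_gidx (x : 'rV[K]_d) (t : K) : 0 < t ->
  exists i : gidx, gscale i <= t < 2 * gscale i /\ `|x - gcenter i| <= gscale i.
Proof.
move=> t0; have [n hn] := exists_expz2 t0.
exists (n, [ffun j => Num.floor (x 0 j / 2 ^ n)]); split => //.
rewrite normrV_le ?ltW ?gscale_gt0//; apply/forallP => j.
rewrite !mxE ffunE /gscale/=.
have s0 : 0 < (2 : K) ^ n by exact: exprz_gt0.
have /andP[f1 f2] := floor_itv (x 0 j / 2 ^ n).
rewrite ler_distl; move: f1 f2; rewrite ler_pdivlMr// ltr_pdivrMr// intrD => f1 f2.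
by apply/andP; split; lra.
Qed.

(** Scales within a factor 32 of each other allow at most six exponents. At each of them the
    rescaled point is within [c^-1] of the integer coordinates, which leaves boundedly many choices,
    uniformly in [y] and [rho]. *)
Lemma grid_count (c : K) : 0 < c ->
  exists N : nat, forall (y : 'rV[K]_d) (rho : K), 0 < rho ->
    exists s : seq gidx, [/\ uniq s, (size s <= N)%N & forall i,
      c * rho <= gscale i <= 32 * (c * rho) -> `|y - gcenter i| <= rho -> i \in s].
Proof.
move=> c0; pose m := (Num.truncn c^-1).+1.
have hm : c^-1 < m%:R by exact: truncnS_gt.
exists #|{: 'I_6 * {ffun 'I_d -> 'I_(m.*2.+3)}}| => y rho r0.
have [n0 /andP[n1 n2]] := exists_expz2 (mulr_gt0 c0 r0).
pose F (ab : 'I_6 * {ffun 'I_d -> 'I_(m.*2.+3)}) : gidx :=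
  let n := n0 + (ab.1 : nat)%:Z in
  (n, [ffun j => Num.floor (y 0 j / 2 ^ n) - m.+1%:Z + (ab.2 j : nat)%:Z]).
exists (undup (codom F)); split; first exact: undup_uniq.
  by rewrite (leq_trans (size_undup _))// size_codom.
move=> [n k] /andP[s1 s2]; rewrite normrV_le ?ltW// => /forallP hy.
rewrite mem_undup; apply/codomP.
rewrite /gscale/= in s1 s2.
have two1 : 1 <= (2 : K) by rewrite ler1n.
have nn0 : n0 <= n.
  rewrite leNgt; apply/negP => nn; have : n + 1 <= n0 by lia.
  move=> /(ler_weXz2l two1); rewrite expfzDr// expr1z; lra.
have nn6 : n < n0 + 6.
  rewrite ltNge; apply/negP => /(ler_weXz2l two1).
  by rewrite expfzDr// -exprnP; lra.
have ha : (`|n - n0|%N < 6)%N by lia.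
have nE : n = n0 + (Ordinal ha : nat)%:Z by rewrite /=; lia.
pose z j : int := k j - Num.floor (y 0 j / 2 ^ n) + m.+1%:Z.
have hb j : (absz (z j) < m.*2.+3)%N /\
    k j = Num.floor (y 0 j / 2 ^ n) - m.+1%:Z + (absz (z j))%:Z.
  have sn0 : 0 < (2 : K) ^ n by exact: exprz_gt0.
  have h1 : `|y 0 j / 2 ^ n - (k j)%:~R| < m%:R.
    apply: le_lt_trans hm; rewrite -(ler_pM2r sn0) -[X in _ * X](gtr0_norm sn0) -normrM.
    rewrite mulrBl divfK ?gt_eqF// mulrC [leRHS]mulrC ler_pdivlMr//.
    have := hy j; rewrite !mxE/= => h.
    have : `|y 0 j - 2 ^ n * (k j)%:~R| * c <= rho * c by rewrite ler_pM2r.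
    by rewrite /gscale/=; nra.
  have /andP[f1 f2] := floor_itv (y 0 j / 2 ^ n).
  move: h1 f1 f2; set u := y 0 j / 2 ^ n; set p := Num.floor u => h1 f1 f2.
  have a1 : k j < p + 1 + m%:Z.
    rewrite -(ltr_int K) !intrD; move: h1; rewrite ltr_norml => /andP[]; rewrite intrD in f2.
    by rewrite -[m%:Z%:~R]/(m%:R : K); lra.
  have a2 : p - m%:Z < k j.
    rewrite -(ltr_int K) !intrD intrN; move: h1; rewrite ltr_norml => /andP[].
    by rewrite -[m%:Z%:~R]/(m%:R : K); lra.
  exact: absz_offset.
exists (Ordinal ha, [ffun j => Ordinal (hb j).1]).
rewrite /F /= -nE; congr (_, _); apply/ffunP => j; rewrite !ffunE/=.
exact: (hb j).2.
Qed.

End Grid.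

(** * The special metric along a segment *)

(** The sharp factor is the square root of [d]; the cruder [d.+1] stays positive when [d = 0], so it
    can serve as a divisor. *)
Lemma enorm_le {K : realType} {d : nat} (v : 'rV[K]_d) : enorm v <= d.+1%:R * `|v|.
Proof.
have h j : `|v 0 j| <= `|v|.
  by have := lexx `|v|; rewrite {1}normrV_le// => /forallP.
rewrite /enorm -[leRHS]ger0_norm ?mulr_ge0// -sqrtr_sqr ler_sqrt ?sqr_ge0//.
apply: (@le_trans _ _ (\sum_(k < d) `|v| ^+ 2)).
  by apply: ler_sum => k _; rewrite -real_normK ?num_real// lerXn2r ?nnegrE.
rewrite sumr_const card_ord -[leLHS]mulr_natl exprMn ler_wpM2r ?sqr_ge0//.
by rewrite -natrX ler_nat; apply: leq_trans (leqnSn d) _; rewrite expnS leq_pmulr.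
Qed.

Lemma is_derive_segment {K : realType} {V : normedModType K} (u v : V) (t : K) :
  is_derive t 1 (fun t : K => u + t *: v) v.
Proof.
have c : (fun h : K => h^-1 *: ((u + (h *: 1 + t) *: v) - (u + t *: v))) @ 0^' --> v.
  have cv : (fun=> v) @ (0 : K)^' --> v by exact: cvg_cst.
  apply: cvg_trans cv; apply: near_eq_cvg; near=> h.
  have h0 : h != 0 by near: h; exact: nbhs_dnbhs_neq.
  by rewrite [_%:A]mulr1 opprD addrACA subrr add0r scalerDl addrK scalerA mulVf// scale1r.
by apply: DeriveDef; [apply/cvg_ex; exists v|exact: cvg_lim c].
Unshelve. all: by end_near. Qed.

Lemma special_metric_segment {K : realType} {d : nat} (Rf : 'rV[K]_d -> K)
    (x y : 'rV[K]_d) (c : K) :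
  0 < c -> (forall t, 0 <= t <= 1 -> c <= Rf (x + t *: (y - x))) ->
  (special_metric Rf x y <= (enorm (y - x) / c)%:E)%E.
Proof.
move=> c0 hc; pose g (t : K) := x + t *: (y - x).
have dg t : derive1 g t = y - x.
  by rewrite derive1E; have [_ ->] := is_derive_segment x (y - x) t.
apply: (@le_trans _ _ (curve_integral Rf g)).
  apply: ereal_inf_lbound; exists g; split => //.
  (* No breakpoints: the segment is C^1 on the whole of [0, 1]. *)
  - exists [::]; split; first by rewrite /= ltr01.
    move=> [|//] _; split; last split.
    + apply: continuous_subspaceT => t.
      apply/differentiable_continuous/derivable1_diffP.
      by have [] := is_derive_segment x (y - x) t.
    + by move=> t _; have [] := is_derive_segment x (y - x) t.
    + exists (cst (y - x)); split; last by move=> t _; exact: dg.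
      by apply: continuous_subspaceT; exact: cst_continuous.
  - by rewrite /g scale0r addr0.
  - by rewrite /g scale1r addrC subrK.
rewrite /curve_integral.
have e0 : 0 <= enorm (y - x) by exact: sqrtr_ge0.
apply: (@le_trans _ _ (\int[@lebesgue_measure K]_(t in `[0%R, 1%R])
    (cst (enorm (y - x) / c)%:E t))%E).
  rewrite (_ : [set t | _] = `[0%R, 1%R]%classic); last first.
    by apply/seteqP; split => t /=; rewrite in_itv.
  apply: ge0_le_integral_any => t /=; rewrite in_itv/= => t01; have R0 := lt_le_trans c0 (hc t t01).
    by rewrite lee_fin dg divr_ge0// ltW.
  by rewrite lee_fin dg ler_wpM2l// lef_pV2// hc.
by rewrite integral_cst//= lebesgue_measure_itv/= lte_fin ltr01 sube0 mule1.
Qed.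

(** * Sums and bump estimates *)

(** Serves to compare the sums over [act x] and [act y]: the lists may differ, but only in indices
    whose bumps vanish. *)
Lemma eq_big_support {R : nmodType} {I : eqType} (l1 l2 : seq I) (f : I -> R) :
  uniq l1 -> uniq l2 ->
  (forall i, i \in l1 -> f i != 0 -> i \in l2) ->
  (forall i, i \in l2 -> f i != 0 -> i \in l1) ->
  \sum_(i <- l1) f i = \sum_(i <- l2) f i.
Proof.
move=> u1 u2 h1 h2.
have E l : \sum_(i <- l) f i = \sum_(i <- [seq i <- l | f i != 0]) f i.
  rewrite big_filter [LHS](bigID (fun i => f i != 0))/= [X in _ + X]big1 ?addr0//.
  by move=> i; rewrite negbK => /eqP.
rewrite E [RHS]E; apply: perm_big; apply: uniq_perm; rewrite ?filter_uniq// => i.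
rewrite !mem_filter; case: eqVneq => //= fi.
by apply/idP/idP => hi; [exact: h1|exact: h2].
Qed.

Lemma nneseries_ge_term {K : realType} (u : nat -> \bar K) (m : nat) :
  (forall k, 0 <= u k)%E -> (u m <= \sum_(k <oo) u k)%E.
Proof.
move=> u0; apply: (@le_trans _ _ (\sum_(0 <= k < m.+1) u k)%E).
  by rewrite big_nat_recr//= leeDr// sume_ge0.
exact: nneseries_lim_ge.
Qed.

Lemma nneseries_le_size {K : realType} (u : nat -> K) (l : seq nat) (b : K) :
  (forall k, 0 <= u k <= b) -> (forall k, u k != 0 -> k \in l) ->
  (\sum_(k <oo) (u k)%:E <= (b * (size l)%:R)%:E)%E.
Proof.
move=> ub ul.
have b0 : 0 <= b by have /andP[] := ub 0%N; exact: le_trans.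
apply: lime_le; first by apply: is_cvg_nneseries => n _ _; rewrite lee_fin; have /andP[] := ub n.
near=> n; rewrite sumEFin lee_fin.
apply: (@le_trans _ _ (\sum_(0 <= k < n | k \in l) b)).
  rewrite [leRHS]big_mkcond; apply: ler_sum => k _.
  case: ifPn => [_|kl]; first by have /andP[] := ub k.
  by case: (eqVneq (u k) 0) => [->//|/ul]; rewrite (negPf kl).
rewrite -big_filter big_const_seq count_predT iter_addr_0 -[leLHS]mulr_natr ler_wpM2l// ler_nat.
apply: uniq_leq_size; first by rewrite filter_uniq ?iota_uniq.
by move=> k; rewrite mem_filter => /andP[].
Unshelve. all: by end_near. Qed.

Section BumpBounds.
Variables (K : realType) (d : nat) (q : 'rV[K]_d) (s : K).
Hypothesis s0 : 0 < s.
Let D : K := d.+1%:R.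

Let D1 : 1 <= D. Proof. by rewrite ler1n. Qed.

Lemma qform_ge0 x : 0 <= qform q s x.
Proof. by apply: sumr_ge0 => j _; exact: sqr_ge0. Qed.

(** A coordinate quotient larger than [D] would alone contribute more than [D ^+ 2], which is at
    least [D]. *)
Lemma qform_lt x : qform q s x < D -> `|x - q| <= D * s.
Proof.
move=> hq; rewrite normrV_le ?mulr_ge0// ?(ltW s0)//; apply/forallP => j.
rewrite !mxE -ler_pdivrMr//.
have hj : ((x 0 j - q 0 j) / s) ^+ 2 < D.
  apply: le_lt_trans hq; rewrite /qform (bigD1 j)//= lerDl.
  by apply: sumr_ge0 => i _; exact: sqr_ge0.
rewrite -[X in _ / X](gtr0_norm s0) -normf_div.
move: hj; rewrite -real_normK ?num_real//; set a := `|_| => hj.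
by rewrite leNgt; apply/negP => aD; have := D1; nra.
Qed.

Lemma qform_le x : `|x - q| <= s -> qform q s x <= d%:R.
Proof.
rewrite normrV_le ?(ltW s0)// => /forallP h.
apply: (@le_trans _ _ (\sum_(j < d) (1 : K))); last by rewrite sumr_const card_ord.
apply: ler_sum => j _; rewrite -real_normK ?num_real// expr_le1//.
by rewrite normf_div (gtr0_norm s0) ler_pdivrMr// mul1r; have := h j; rewrite !mxE.
Qed.

Lemma bumpf_ge0 x : 0 <= bumpf q s x.
Proof. exact: ppow_ge0. Qed.

Lemma bumpf_ge1 x : `|x - q| <= s -> 1 <= bumpf q s x.
Proof.
move=> /qform_le h; have D0 : 1 <= d.+1%:R - qform q s x by rewrite -natr1; lra.
by rewrite /bumpf ppow_gt0 ?exprn_ege1//; lra.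
Qed.

Lemma bumpf_eq0 x : D * s < `|x - q| ->
  [/\ bumpf q s x = 0, forall k, bumpf1 q s k x = 0 & forall k l, bumpf2 q s k l x = 0].
Proof.
move=> h; have h0 : D - qform q s x <= 0.
  by rewrite subr_le0 leNgt; apply/negP => /qform_lt; rewrite leNgt h.
by rewrite /bumpf /bumpf1 /bumpf2; split => [|k|k l];
  rewrite !ppow0// !(mulr0, mul0r, oppr0, addr0).
Qed.

Lemma ppow_qform_le n x : ppow n (D - qform q s x) <= D ^+ n.
Proof.
have D0 : 0 <= D by rewrite (le_trans ler01).
apply: lerXn2r; rewrite ?nnegrE ?le_max ?lexx//.
by rewrite ge_max D0/= gerBl qform_ge0.
Qed.

Let coord_le k x : `|x - q| <= D * s -> `|(x 0 k - q 0 k) / s| <= D.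
Proof.
rewrite normrV_le ?mulr_ge0// ?(ltW s0)// => /forallP/(_ k).
by rewrite !mxE normf_div (gtr0_norm s0) ler_pdivrMr.
Qed.

Let factor_le k x : `|x - q| <= D * s -> `|2 * ((x 0 k - q 0 k) / s) / s| <= 2 * D / s.
Proof.
move=> /(coord_le k) h; rewrite !normrM (gtr0_norm (_ : 0 < s^-1)) ?invr_gt0// in h *.
by rewrite ler_wpM2r ?invr_ge0 ?(ltW s0)// gtr0_norm// ler_wpM2l.
Qed.

Let ppow3_le (a : K) n x : 0 <= a -> a * ppow n (D - qform q s x) <= a * D ^+ n.
Proof. by move=> a0; rewrite ler_wpM2l// ppow_qform_le. Qed.

Let ppow3_norm (a : K) n x : 0 <= a ->
  `|a * ppow n (d.+1%:R - qform q s x)| = a * ppow n (D - qform q s x).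
Proof. by move=> a0; rewrite ger0_norm// mulr_ge0 ?ppow_ge0. Qed.

Lemma bumpf1_le k x : `|bumpf1 q s k x| <= 6 * D ^+ 3 / s.
Proof.
have D0 : 0 <= D by rewrite (le_trans ler01).
have [h|/bumpf_eq0[_ -> _]] := leP (`|x - q|) (D * s); last first.
  by rewrite normr0 !mulr_ge0 ?invr_ge0 ?exprn_ge0 ?(ltW s0).
rewrite /bumpf1 normrM normrN ppow3_norm//.
rewrite (_ : 6 * D ^+ 3 / s = 3 * D ^+ 2 * (2 * D / s)); last by ring.
apply: ler_pM; [by rewrite mulr_ge0 ?ppow_ge0|by []|by rewrite ppow3_le|exact: factor_le].
Qed.

(** On the enlarged cube every coordinate quotient is at most [D]; elsewhere the derivative
    vanishes. The two terms give 24 [D ^+ 3] and 6 [D ^+ 2], merged into 30 [D ^+ 3] by [1 <= D]. *)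
Lemma bumpf2_le k l x : `|bumpf2 q s k l x| <= 30 * D ^+ 3 / s ^+ 2.
Proof.
have D0 : 0 <= D by rewrite (le_trans ler01).
have si : 0 <= s^-1 by rewrite invr_ge0 ltW.
have [h|/bumpf_eq0[_ _ ->]] := leP (`|x - q|) (D * s); last first.
  by rewrite normr0 !mulr_ge0 ?invr_ge0 ?exprn_ge0 ?(ltW s0).
rewrite /bumpf2 (le_trans (ler_normD _ _))//.
apply: (@le_trans _ _ (6 * D ^+ 1 * (2 * D / s) * (2 * D / s) + 3 * D ^+ 2 * (2 / s ^+ 2))).
  apply: lerD.
    rewrite 2!normrM ppow3_norm//.
    apply: ler_pM; [by rewrite !mulr_ge0 ?ppow_ge0|by []| |exact: factor_le].
    by apply: ler_pM; [by rewrite mulr_ge0 ?ppow_ge0|by []|rewrite ppow3_le|exact: factor_le].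
  rewrite normrM normrN ppow3_norm//.
  apply: ler_pM; [by rewrite mulr_ge0 ?ppow_ge0|by []|by rewrite ppow3_le|].
  rewrite ger0_norm ?mulr_ge0 ?invr_ge0 ?exprn_ge0 ?(ltW s0)//.
  rewrite -mulrA ler_piMl// ?mulr_ge0 ?invr_ge0 ?exprn_ge0 ?(ltW s0)//.
  by case: (k == l); rewrite ?ler01.
have -> : 6 * D ^+ 1 * (2 * D / s) * (2 * D / s) + 3 * D ^+ 2 * (2 / s ^+ 2) =
  (24 * D ^+ 3 + 6 * D ^+ 2) / s ^+ 2 by field; rewrite gt_eqF.
rewrite ler_wpM2r ?invr_ge0 ?exprn_ge0 ?(ltW s0)//.
have : D ^+ 2 <= D ^+ 3 by rewrite ler_weXn2l.
lra.
Qed.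

End BumpBounds.

(** * Construction of the cutoff *)

Section Construction.
Variables (K : realType) (d : nat) (Rf : 'rV[K]_d -> K) (U : set 'rV[K]_d).
Hypothesis Rf_gt0 : forall x, 0 < Rf x.
Hypothesis Rf_lip : forall x y, `|Rf x - Rf y| <= enorm (x - y).

Let D : K := d.+1%:R.
(** Cubes have radius about [c * rad], so that even after enlargement by the factor [D] they stay
    within a few hundredths of [rad]. *)
Let c : K := (100 * D)^-1.

Let D1 : 1 <= D. Proof. by rewrite ler1n. Qed.
Let D0 : 0 < D. Proof. exact: lt_le_trans D1. Qed.
Let cD : c * D = 100^-1. Proof. by rewrite /c; field; rewrite gt_eqF. Qed.
Let c0 : 0 < c. Proof. by rewrite invr_gt0 mulr_gt0. Qed.
Let c1 : c <= 100^-1. Proof. by rewrite -cD ler_peMr// ltW. Qed.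

(* Dividing by [d + 1] makes the radius 1-Lipschitz for the sup norm. *)
Definition rad (x : 'rV[K]_d) : K := Rf x / D.

Let rad_gt0 x : 0 < rad x. Proof. by rewrite divr_gt0. Qed.

Let rad_le x y : rad x <= rad y + `|x - y|.
Proof.
rewrite /rad ler_pdivrMr// mulrDl divfK ?gt_eqF//.
have := le_trans (Rf_lip x y) (enorm_le _); rewrite ler_norml -/D.
by move=> /andP[_]; rewrite mulrC; lra.
Qed.

Let dist_le (z x y : 'rV[K]_d) : `|x - y| <= `|x - z| + `|y - z|.
Proof. by rewrite (distrC y z); exact: ler_distD. Qed.

Local Notation sc i := (@gscale K d i).
Local Notation ct i := (@gcenter K d i).

(** The window for the scale contains the dyadic scale just below [c * rad x] for each [x] in the
    cube, with room for the variation of [rad]. The radius 1/5 lies between 9/50, where [total] must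
    reach 1, and 1/4, the reach of the supports. *)
Definition sel : set (gidx d) := [set i |
  c / 4 * rad (ct i) <= sc i <= 2 * c * rad (ct i) /\
  exists2 u, U u & `|ct i - u| <= rad (ct i) / 5].

Let sel_le i : sel i -> D * sc i <= rad (ct i) / 50.
Proof.
move=> [/andP[_ h] _]; have := ler_wpM2l (ltW D0) h.
have -> : D * (2 * c * rad (ct i)) = 2 * (c * D) * rad (ct i) by ring.
rewrite cD; lra.
Qed.

Let sel_scale_le i : sel i -> sc i <= D * sc i.
Proof. by move=> _; rewrite ler_peMl// ltW// gscale_gt0. Qed.

(** Supplied by [grid_count] with the constant [c / 8]: near each point, a list of at most [N]
    indices containing all those of comparable scale and position. *)
Variables (N : nat) (cov : 'rV[K]_d -> seq (gidx d)).
Hypothesis cov_uniq : forall x, uniq (cov x).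
Hypothesis cov_size : forall x, (size (cov x) <= N)%N.
Hypothesis cov_mem : forall x i,
  c / 8 * rad x <= sc i <= 32 * (c / 8 * rad x) -> `|x - ct i| <= rad x -> i \in cov x.

Definition act x : seq (gidx d) := [seq i <- cov x | `[< sel i >]].

Let act_uniq x : uniq (act x). Proof. exact: filter_uniq. Qed.

Let act_size x : (size (act x) <= N)%N.
Proof. by rewrite size_filter (leq_trans (count_size _ _)). Qed.

Let act_sel x i : i \in act x -> sel i.
Proof. by rewrite mem_filter => /andP[/asboolP]. Qed.

(** Within half of [rad x], the values of [rad] at [x] and at the center are comparable, so the
    window in [sel] falls inside the larger window covered by [cov]. *)
Let act_mem x i : sel i -> `|x - ct i| <= rad x / 2 -> i \in act x.
Proof.
move=> si h; rewrite mem_filter; apply/andP; split; first exact/asboolP.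
have [/andP[h1 h2] _] := si.
have r1 := rad_le x (ct i); have r2 := rad_le (ct i) x; rewrite distrC in r2.
have rx := rad_gt0 x.
apply: cov_mem; last by lra.
have k1 : rad x / 2 <= rad (ct i) by lra.
have k2 : rad (ct i) <= 3 / 2 * rad x by lra.
by apply/andP; split; nra.
Qed.

Definition total x : K := \sum_(i <- act x) bumpf (ct i) (sc i) x.

Definition cutoff x : K := step (total x).

Let near_rad i x : sel i -> `|x - ct i| <= D * sc i -> `|x - ct i| <= rad x / 49.
Proof.
move=> /sel_le h1 h2; have := rad_le (ct i) x; rewrite distrC; lra.
Qed.

Let total_ge0 x : 0 <= total x.
Proof. by apply: sumr_ge0 => i _; exact: bumpf_ge0. Qed.

Let bumpf_neq0 i x : bumpf (ct i) (sc i) x != 0 -> `|x - ct i| <= D * sc i.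
Proof.
move=> h; rewrite leNgt; apply/negP => /(bumpf_eq0 (gscale_gt0 _ i))[b0 _ _].
by rewrite b0 eqxx in h.
Qed.

(** The list [act y] changes with [y], but a bump that is nonzero at [y] has its center within
    [rad y / 49]. For [y] close to [x] such an index lies in [act x] too, and conversely. *)
Let total_near x : \forall y \near x, total y = \sum_(i <- act x) bumpf (ct i) (sc i) y.
Proof.
have e0 : 0 < rad x / 10 by rewrite divr_gt0.
near=> y.
have yx : `|x - y| < rad x / 10.
  by near: y; exact: (@cvgr_dist_lt _ _ _ (nbhs x) _ id x cvg_id _ e0).
have r1 := rad_le y x; have r2 := rad_le x y; rewrite distrC in r1.
have rx := rad_gt0 x.
apply: eq_big_support => // i ia /bumpf_neq0 /(near_rad (act_sel ia)) h.
  apply: act_mem; first exact: act_sel ia.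
  have := dist_le y x (ct i); rewrite (distrC (ct i) y); lra.
by apply: act_mem; [exact: act_sel ia|lra].
Unshelve. all: by end_near. Qed.

Let act_jet x := jet2_step (jet2_sum (act x) (fun i => jet2_bumpf (ct i) (sc i))).

Let cutoff_near x : \forall y \near x,
  cutoff y = step (\sum_(i <- act x) bumpf (ct i) (sc i) y).
Proof.
by near=> y; rewrite /cutoff; congr step; near: y; exact: total_near.
Unshelve. all: by end_near. Qed.

Lemma cutoff_C2 : C2 cutoff.
Proof.
apply: jet2_near => x.
by do 3 eexists; split; [exact: (act_jet x)|exact: cutoff_near].
Qed.

Lemma cutoff_itv x : 0 <= cutoff x <= 1.
Proof.
have := total_ge0 x; rewrite /cutoff /step => t0.
rewrite gerBl ppow_ge0 andbT subr_ge0 /ppow exprn_ile1 ?le_max ?lexx//.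
by rewrite ge_max ler01/= gerBl.
Qed.

Let cutoff1 x i : sel i -> `|x - ct i| <= sc i -> 1 <= total x.
Proof.
move=> si h; have ia : i \in act x.
  apply: act_mem => //; have := near_rad si (le_trans h (sel_scale_le si)).
  have := rad_gt0 x; lra.
rewrite /total (bigD1_seq i)//= ler_wpDr ?bumpf_ge1 ?gscale_gt0//.
by apply: sumr_ge0 => j _; exact: bumpf_ge0.
Qed.

(** The grid cube of scale about [c * rad x] around [x] has its center close enough to [U] to be
    selected. Since this works on a whole neighborhood of [U], points with [total] below 1 keep a
    definite distance from [U]. *)
Lemma total_ge1 x u : U u -> `|x - u| <= 9 / 50 * rad x -> 1 <= total x.
Proof.
move=> Uu xu; have [i [/andP[s1 s2] xi]] := exists_gidx x (mulr_gt0 c0 (rad_gt0 x)).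
apply: (cutoff1 _ xi).
have rx := rad_gt0 x.
have r1 := rad_le x (ct i); have r2 := rad_le (ct i) x; rewrite distrC in r2.
have sx : sc i <= rad x / 100 by apply: le_trans s1 _; rewrite mulrC ler_wpM2l// ltW.
split; first by apply/andP; split; nra.
exists u => //; have := dist_le x (ct i) u; rewrite (distrC (ct i) x) (distrC u x); lra.
Qed.

Lemma cutoff_eq1 x : 1 <= total x -> cutoff x = 1.
Proof. by move=> t1; rewrite /cutoff /step ppow0 ?subr0// subr_le0. Qed.

Lemma sel_dist i x : sel i -> `|x - ct i| <= D * sc i ->
  exists2 u, U u & `|x - u| <= rad x / 4.
Proof.
move=> si h; have [_ [u Uu iu]] := si; exists u => //.
have := near_rad si h; have := rad_le (ct i) x; have := dist_le (ct i) x u.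
have := rad_gt0 x; rewrite (distrC u) (distrC (ct i) x); lra.
Qed.

(** Along the segment [rad] stays above half of [rad x], so its length in the special metric is at
    most 1/2, well below 4. *)
Lemma neigh_dist u x : U u -> `|x - u| <= rad x / 4 -> neigh Rf U 4 x.
Proof.
move=> Uu xu; exists u => //; have rx := rad_gt0 x.
have e0 : 0 < D * (rad x / 2) by rewrite mulr_gt0// divr_gt0.
have seg t : 0 <= t <= 1 -> D * (rad x / 2) <= Rf (u + t *: (x - u)).
  move=> /andP[t0 t1]; set z := u + t *: (x - u).
  have -> : Rf z = D * rad z by rewrite /rad mulrC divfK ?gt_eqF.
  rewrite ler_pM2l//; have := rad_le x z.
  have -> : x - z = (1 - t) *: (x - u).
    by rewrite /z scalerBl scale1r opprD addrA.
  by rewrite normrZ ger0_norm ?subr_ge0//; have := normr_ge0 (x - u); nra.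
apply: le_trans (special_metric_segment e0 seg) _.
rewrite lee_fin ler_pdivrMr//.
have := enorm_le (x - u); rewrite -/D.
have : D * `|x - u| <= D * (rad x / 4) by rewrite ler_pM2l.
have : 0 < D * rad x by rewrite mulr_gt0.
by lra.
Qed.

Lemma cutoff_neq0 x : cutoff x <> 0 -> exists2 i, sel i & `|x - ct i| <= D * sc i.
Proof.
move=> f0; apply: contrapT => h; apply: f0.
rewrite /cutoff /total big_seq big1 ?/step ?subr0 ?ppow_gt0 ?expr1n ?subrr// => i ia.
by apply/eqP/negPn/negP => /bumpf_neq0 b; apply: h; exists i => //; exact: act_sel ia.
Qed.

(** Where [total] is at least 1, the derivatives of the cutoff vanish with the truncated powers in
    them. Only selected cubes whose enlargement leaves that region can carry energy. *)
Definition layer : set (gidx d) := [set i |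
  sel i /\ exists x, `|x - ct i| <= D * sc i /\ total x < 1].

(* A point of the layer is neither too close to [U] nor too far from it, so the
   cube around the midpoint of the segment to a close point of [U] avoids [U]
   and lies where the cutoff equals 1. *)
Lemma layer_translate i : layer i -> exists z, forall y, `|y - z| <= D * sc i ->
  [/\ (neigh Rf U 4 `\` U) y, cutoff y = 1 & i \in act y].
Proof.
move=> [si [x [xi tx]]]; have [u Uu xu] := sel_dist si xi.
have far v : U v -> 9 / 50 * rad x < `|x - v|.
  by move=> Uv; rewrite ltNge; apply/negP => /(total_ge1 Uv); rewrite leNgt tx.
exists (2^-1 *: (x + u)) => y yz; set z := _ *: _ in yz.
have xz : `|x - z| = `|x - u| / 2.
  have -> : x - z = 2^-1 *: (x - u).
    by apply/rowP => j; rewrite /z !mxE; field.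
  by rewrite normrZ ger0_norm ?invr_ge0// mulrC.
have uz : `|u - z| = `|x - u| / 2.
  have -> : u - z = 2^-1 *: (u - x).
    by apply/rowP => j; rewrite /z !mxE; field.
  by rewrite normrZ ger0_norm ?invr_ge0// mulrC (distrC u).
have rx := rad_gt0 x.
have h1 := sel_le si; have h2 := near_rad si xi.
have r1 := rad_le (ct i) x; rewrite distrC in r1.
(* The constant 73/500 bounds 1/8 + 1/49, half the distance to [u] plus the radius of the cube. It
   is below 9/50, so [y] is not in [U], and below 9/50 of 427/500, so [y] is close enough to [u] for
   [total y] to reach 1. *)
have yx : `|y - x| <= 73 / 500 * rad x by have := dist_le z y x; lra.
have yu : `|y - u| <= 73 / 500 * rad x by have := dist_le z y u; lra.
have r2 := rad_le x y; rewrite distrC in r2.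
have ty : 1 <= total y by apply: (total_ge1 Uu); lra.
have fy := cutoff_eq1 ty.
split => //; last first.
  (* The translate stays near the original cube, so [act y] also counts the translates that contain
     [y]. *)
  by apply: act_mem => //; have := dist_le x y (ct i); rewrite (distrC (ct i) x); lra.
split; last by move=> /far; rewrite distrC; lra.
by apply: (neigh_dist Uu); lra.
Qed.

(** * Pointwise bounds on the derivatives of the cutoff *)

Let kappa : K := 5 / c.

Let kappa0 : 0 < kappa. Proof. by rewrite divr_gt0. Qed.

(** The lower bound [c / 4] in [sel] costs a factor 4, and the variation of [rad] over the cube a
    factor 51/50; 5 covers both. *)
Let inv_scale i x : sel i -> `|x - ct i| <= D * sc i -> (sc i)^-1 <= kappa / rad x.
Proof.
move=> si xi; have h := sel_le si; have r := rad_le x (ct i).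
have [/andP[s1 _] _] := si.
have s2 : c * rad x <= 5 * sc i.
  have : c * rad x <= c * (51 / 50 * rad (ct i)) by rewrite ler_pM2l//; lra.
  have : 0 < c * rad (ct i) by rewrite mulr_gt0.
  by lra.
have -> : kappa / rad x = (c * rad x / 5)^-1.
  by rewrite /kappa; field; rewrite !gt_eqF.
rewrite lef_pV2 ?posrE ?gscale_gt0//; last by rewrite divr_gt0// mulr_gt0.
by rewrite ler_pdivrMr// [leRHS]mulrC.
Qed.

Let sum_act_le (x : 'rV[K]_d) (f : gidx d -> K) (b : K) : 0 <= b ->
  (forall i, i \in act x -> `|f i| <= b) -> `|\sum_(i <- act x) f i| <= N%:R * b.
Proof.
move=> b0 fb; apply: le_trans (ler_norm_sum _ _ _) _.
apply: (@le_trans _ _ (\sum_(i <- act x) b)).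
  by rewrite big_seq [leRHS]big_seq; apply: ler_sum => i /fb.
by rewrite big_const_seq count_predT iter_addr_0 -[leLHS]mulr_natl ler_wpM2r// ler_nat.
Qed.

Let G : K := N%:R * (6 * D ^+ 3 * kappa).
Let H : K := N%:R * (30 * D ^+ 3 * kappa ^+ 2).

Let partial_cutoff k x : partial k cutoff x =
  3 * ppow 2 (1 - total x) * \sum_(i <- act x) bumpf1 (ct i) (sc i) k x.
Proof.
rewrite (nbhs_singleton (near_partial k (cutoff_near x))).
by rewrite (jet2_partial _ (act_jet x)).
Qed.

Let partial2_cutoff k l x : partial l (partial k cutoff) x =
  - (6 * ppow 1 (1 - total x)) * (\sum_(i <- act x) bumpf1 (ct i) (sc i) l x)
    * (\sum_(i <- act x) bumpf1 (ct i) (sc i) k x)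
  + 3 * ppow 2 (1 - total x) * \sum_(i <- act x) bumpf2 (ct i) (sc i) k l x.
Proof.
rewrite (nbhs_singleton (near_partial l (near_partial k (cutoff_near x)))).
by rewrite (jet2_partial2 _ _ (act_jet x)).
Qed.

Let kD0 : (0 <= D) * (0 <= kappa) * (forall x, 0 <= (rad x)^-1) *
  (forall x, 0 <= (rad x ^+ 2)^-1).
Proof. by do !split; rewrite ?ltW// => x; rewrite invr_ge0 ?exprn_ge0 ?ltW. Qed.

Let sum1_le k x : `|\sum_(i <- act x) bumpf1 (ct i) (sc i) k x| <= G / rad x.
Proof.
rewrite /G -mulrA; apply: sum_act_le.
  by rewrite !(kD0, exprn_ge0, mulr_ge0).
move=> i /act_sel si; have [xi|xi] := leP (`|x - ct i|) (D * sc i).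
  apply: le_trans (bumpf1_le _ (gscale_gt0 _ i) k x) _.
  by rewrite -[leRHS]mulrA ler_wpM2l ?inv_scale// !(kD0, exprn_ge0, mulr_ge0).
have [_ -> _] := bumpf_eq0 (gscale_gt0 _ i) xi.
by rewrite normr0 !(kD0, exprn_ge0, mulr_ge0).
Qed.

Let sum2_le k l x : `|\sum_(i <- act x) bumpf2 (ct i) (sc i) k l x| <= H / rad x ^+ 2.
Proof.
rewrite /H -mulrA; apply: sum_act_le.
  by rewrite !(kD0, exprn_ge0, mulr_ge0).
move=> i /act_sel si; have [xi|xi] := leP (`|x - ct i|) (D * sc i).
  apply: le_trans (bumpf2_le _ (gscale_gt0 _ i) k l x) _.
  rewrite -[leRHS]mulrA ler_wpM2l ?(kD0, exprn_ge0, mulr_ge0)// -exprVn -exprVn -exprMn.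
  apply: lerXn2r; rewrite ?nnegrE ?inv_scale//.
    by rewrite invr_ge0 ltW// gscale_gt0.
  by rewrite !(kD0, mulr_ge0).
have [_ _ ->] := bumpf_eq0 (gscale_gt0 _ i) xi.
by rewrite normr0 !(kD0, exprn_ge0, mulr_ge0).
Qed.

Let ppow_total n x : 0 <= ppow n (1 - total x) <= 1.
Proof.
rewrite ppow_ge0/= exprn_ile1 ?le_max ?lexx//.
by rewrite ge_max ler01/= gerBl.
Qed.

Definition energy x : K :=
  Rf x * grad_norm cutoff x + Rf x ^+ 2 * hess_norm cutoff x.

(** Built from [d] and [N] alone, so the final constant can be fixed before [Rf] and [U]. The powers
    of [D] come from [Rf x = D * rad x]. *)
Definition energy_bound : K :=
  D * (d%:R * (3 * G)) + D ^+ 2 * (d%:R * (d%:R * (6 * G ^+ 2 + 3 * H))).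

Lemma energy_ge0 x : 0 <= energy x.
Proof.
apply: addr_ge0; apply: mulr_ge0; rewrite ?exprn_ge0 ?(ltW (Rf_gt0 x))//.
  by apply: sumr_ge0 => k _.
by apply: sumr_ge0 => k _; apply: sumr_ge0 => l _.
Qed.

Lemma energy_le x : energy x <= energy_bound.
Proof.
have rx := rad_gt0 x; have Rx : Rf x = D * rad x by rewrite /rad mulrC divfK ?gt_eqF.
have G0 : 0 <= G by rewrite !(kD0, exprn_ge0, mulr_ge0).
have H0 : 0 <= H by rewrite !(kD0, exprn_ge0, mulr_ge0).
have p1 k : `|partial k cutoff x| <= 3 * G / rad x.
  rewrite partial_cutoff normrM -mulrA; apply: ler_pM => //.
  by have /andP[? ?] := ppow_total 2 x; rewrite ger0_norm; lra.
have p2 k l : `|partial l (partial k cutoff) x| <= (6 * G ^+ 2 + 3 * H) / rad x ^+ 2.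
  rewrite partial2_cutoff [leRHS]mulrDl; apply: le_trans (ler_normD _ _) _; apply: lerD.
    rewrite (_ : 6 * G ^+ 2 / rad x ^+ 2 = 6 * (G / rad x) * (G / rad x)); last first.
      by field; rewrite gt_eqF.
    rewrite 2!normrM; apply: ler_pM => //.
    apply: ler_pM => //.
    by have /andP[? ?] := ppow_total 1 x; rewrite normrN ger0_norm; lra.
  rewrite normrM -mulrA; apply: ler_pM => //.
  by have /andP[? ?] := ppow_total 2 x; rewrite ger0_norm; lra.
have sumc (a : K) (f : 'I_d -> K) : (forall k, f k <= a) -> \sum_(k < d) f k <= d%:R * a.
  move=> fa; apply: le_trans (ler_sum _ (fun k _ => fa k)) _.
  by rewrite sumr_const card_ord -[leLHS]mulr_natl.
rewrite /energy /energy_bound Rx; apply: lerD.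
  rewrite -mulrA ler_pM2l//.
  have -> : d%:R * (3 * G) = rad x * (d%:R * (3 * G / rad x)) by field; rewrite gt_eqF.
  by rewrite ler_pM2l//; apply: sumc.
rewrite exprMn -mulrA ler_pM2l ?exprn_gt0//.
have -> : d%:R * (d%:R * (6 * G ^+ 2 + 3 * H)) =
  rad x ^+ 2 * (d%:R * (d%:R * ((6 * G ^+ 2 + 3 * H) / rad x ^+ 2))) by field; rewrite gt_eqF.
by rewrite ler_pM2l ?exprn_gt0//; apply: (sumc) => k; exact: sumc.
Qed.

Lemma energy_layer x : energy x != 0 -> exists2 i, layer i & `|x - ct i| <= D * sc i.
Proof.
move=> e0; apply: contrapT => h.
suff [z1 z2] : (forall k, partial k cutoff x = 0) /\
               (forall k l, partial l (partial k cutoff) x = 0).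
  move: e0; rewrite /energy /grad_norm /hess_norm !big1 ?mulr0 ?addr0 ?eqxx//.
    by move=> k _; rewrite big1// => l _; rewrite z2 normr0.
  by move=> k _; rewrite z1 normr0.
(* Either the truncated powers in front vanish, or [x] lies outside the enlarged cubes of all active
   bumps and the derivatives of these bumps vanish. *)
have [t1|t1] := leP 1 (total x).
  by split => [k|k l]; rewrite ?partial_cutoff ?partial2_cutoff !ppow0 ?subr_le0//
    !(mulr0, mul0r, oppr0, addr0).
have far i : i \in act x -> D * sc i < `|x - ct i|.
  move=> /act_sel si; rewrite ltNge; apply/negP => xi; apply: h; exists i => //.
  by split => //; exists x.
have s1 k : \sum_(i <- act x) bumpf1 (ct i) (sc i) k x = 0.
  by rewrite big_seq big1// => i /far /(bumpf_eq0 (gscale_gt0 _ i))[].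
have s2 k l : \sum_(i <- act x) bumpf2 (ct i) (sc i) k l x = 0.
  by rewrite big_seq big1// => i /far /(bumpf_eq0 (gscale_gt0 _ i))[].
by split => [k|k l]; rewrite ?partial_cutoff ?partial2_cutoff ?s1 ?s2 !mulr0 ?addr0.
Qed.

(** * Comparison of the integrals by translating cubes *)

Lemma int_energy_le :
  (int_Rd (fun x => (energy x)%:E) <=
   ((`|energy_bound| + 1) * N.+1%:R)%:E *
     int_Rd (fun x => (\1_(neigh Rf U 4 `\` U) x * cutoff x)%:E))%E.
Proof.
set M := `|energy_bound| + 1; set C := M * N.+1%:R.
have M0 : 0 < M by rewrite ltr_wpDl.
have C0 : 0 < C by rewrite mulr_gt0.
have /choice[zf zfP] : forall i, exists z, layer i -> forall y, `|y - z| <= D * sc i ->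
    [/\ (neigh Rf U 4 `\` U) y, cutoff y = 1 & i \in act y].
  move=> i; have [/layer_translate[z hz]|nl] := pselect (layer i); first by exists z.
  by exists 0.
(* Cubes are listed through their codes; numbers that code no index, and indices outside the layer,
   get weight 0. *)
pose o m : option (gidx d) := pickle_inv m.
pose w m : K := if o m is Some i then (if `[< layer i >] then M else 0) else 0.
pose a m : K := if o m is Some i then D * sc i else 0.
pose qf m := if o m is Some i then ct i else 0.
pose zz m := if o m is Some i then zf i else 0.
have w0 m : 0 <= w m by rewrite /w; case: (o m) => // i; case: ifP => // _; exact: ltW.
have a0 m : 0 <= a m.
  by rewrite /a; case: (o m) => // i; rewrite mulr_ge0 ?ltW// gscale_gt0.
(* The energy is at most [M] and vanishes off the enlarged layer cubes, so one cube containing the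
   point already dominates it. *)
apply: (@le_trans _ _ (int_Rd (fun x =>
    \sum_(m <oo) (w m * cube (enum 'I_d) (qf m) (a m) x)%:E)%E)).
  apply: le_iter_int => x; first by rewrite lee_fin energy_ge0.
  have t0 m : (0 <= (w m * cube (enum 'I_d) (qf m) (a m) x)%:E)%E.
    by rewrite lee_fin mulr_ge0// cube_ge0.
  have [->|/energy_layer[i li xi]] := eqVneq (energy x) 0; first exact: nneseries_ge0.
  apply: le_trans (nneseries_ge_term (pickle i) t0).
  rewrite lee_fin cubeE// /w /a /qf /o pickleK_inv xi mulr1; case: asboolP => // _.
  by apply: le_trans (energy_le x) _; rewrite /M ler_wpDr// ler_norm.
rewrite int_Rd_cubes//.
have wC0 m : 0 <= w m / C by rewrite divr_ge0// ltW.
(* Moving each cube from [qf m] to [zz m] keeps its volume, so the series is unchanged up to the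
   factor [C] taken out of the weights. *)
rewrite (_ : (\sum_(m <oo) _)%E = (C%:E *
    int_Rd (fun x => \sum_(m <oo) (w m / C * cube (enum 'I_d) (zz m) (a m) x)%:E))%E); last first.
  rewrite int_Rd_cubes// -nneseriesZl; last first.
    by move=> m _; rewrite lee_fin mulr_ge0// exprn_ge0// mulr_ge0.
  by apply: eq_eseriesr => m _; rewrite -EFinM; congr EFin; field; rewrite gt_eqF.
rewrite lee_pmul2l// ?lte_fin//; apply: le_iter_int => y.
  by apply: nneseries_ge0 => m _ _; rewrite lee_fin mulr_ge0// cube_ge0.
have term m : w m / C * cube (enum 'I_d) (zz m) (a m) y != 0 ->
    exists i, [/\ o m = Some i, layer i & `|y - zf i| <= D * sc i].
  rewrite cubeE// /w /a /zz; case: (o m) => [i|]; last by rewrite !mul0r eqxx.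
  case: asboolP => li; last by rewrite !mul0r eqxx.
  case: (boolP (`|y - zf i| <= _)) => [yi _|_]; last by rewrite mulr0 eqxx.
  by exists i.
(* If no translate contains [y], the sum is 0. Otherwise the right-hand integrand is 1 at [y], while
   at most [N] translates of weight at most [M / C] contribute, for a total of at most N/(N+1). *)
have [[m hm]|h] := pselect (exists m, w m / C * cube (enum 'I_d) (zz m) (a m) y != 0); last first.
  rewrite eseries0; last first.
    by move=> m _ _; apply/eqP; rewrite eqe; apply/negPn/negP => hm; apply: h; exists m.
  by rewrite lee_fin mulr_ge0// ?indicE//; have /andP[] := cutoff_itv y.
have [i [_ li yi]] := term m hm; have [ny fy _] := zfP i li y yi.
rewrite indicE mem_set// fy mulr1.
apply: le_trans (@nneseries_le_size _ _ (map pickle (act y)) (M / C) _ _) _.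
- move=> k; rewrite mulr_ge0 ?cube_ge0//= cubeE//.
  have wM : w k <= M by rewrite /w; case: (o k) => [j|]; [case: ifP => // _|]; rewrite ltW.
  apply: (@le_trans _ _ (w k / C)); first by rewrite ler_piMr// lern1 leq_b1.
  by rewrite ler_wpM2r// invr_ge0 ltW.
- move=> k /term[j [oj lj yj]]; have [_ _ jy] := zfP j lj y yj.
  have <- : pickle j = k; last exact: map_f.
  by have : oapp pickle k (o k) = k := pickle_invK _; rewrite oj.
- rewrite lee_fin size_map /C invfM mulrA divff ?gt_eqF// mul1r mulrC.
  rewrite ler_pdivrMr// mul1r ler_nat.
  exact: leq_trans (act_size y) _.
Qed.

End Construction.

(** * Choice of a constant depending only on the dimension, and conclusion *)

Theorem theorem2p1 (K : realType) (d : nat) :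
  exists C : K, 0 < C /\
  forall (Rf : 'rV[K]_d -> K) (U : set 'rV[K]_d),
    (forall x, 0 < Rf x) ->
    (forall x y, `|Rf x - Rf y| <= enorm (x - y)) ->
    closed U ->
    exists f : 'rV[K]_d -> K,
      [/\ C2 f,
          (forall x, 0 <= f x <= 1),
          (forall x, U x -> f x = 1),
          (forall x, ~ neigh Rf U 4 x -> f x = 0) &
          (int_Rd (fun x => (Rf x * grad_norm f x + Rf x ^+ 2 * hess_norm f x)%:E)
           <= C%:E * int_Rd (fun x => (\1_(neigh Rf U 4 `\` U) x * f x)%:E))%E].
Proof.
have c0 : 0 < (100 * d.+1%:R)^-1 / 8 :> K by rewrite divr_gt0// invr_gt0 mulr_gt0.
(* The overlap bound is fixed before [Rf] and [U] are introduced. *)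
have [N hN] := grid_count d c0.
exists ((`|energy_bound K d N| + 1) * N.+1%:R); split.
  by rewrite mulr_gt0// ltr_wpDl.
move=> Rf U R0 RL _.
have rad_gt0 x : 0 < rad Rf x by rewrite divr_gt0.
have /choice[cov covP] : forall x, exists s : seq (gidx d), [/\ uniq s, (size s <= N)%N &
    forall i, (100 * d.+1%:R)^-1 / 8 * rad Rf x <= gscale K i <=
                32 * ((100 * d.+1%:R)^-1 / 8 * rad Rf x) ->
              `|x - gcenter K i| <= rad Rf x -> i \in s].
  by move=> x; exact: hN.
have cov_u x : uniq (cov x) by have [] := covP x.
have cov_s x : (size (cov x) <= N)%N by have [] := covP x.
have cov_m x : forall i, _ := let: And3 _ _ h := covP x in h.
exists (cutoff Rf U cov); split.
- exact: cutoff_C2 cov_m.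
- exact: cutoff_itv.
- move=> x Ux; apply: cutoff_eq1.
  by apply: (total_ge1 R0 RL cov_u cov_m Ux); rewrite subrr normr0 mulr_ge0// ltW.
- move=> x nx; apply: contrapT => /cutoff_neq0[i si xi]; apply: nx.
  by have [u Uu xu] := sel_dist R0 RL si xi; exact: neigh_dist Uu xu.
- exact: int_energy_le.
Qed.
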